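(* Let $G$ be a connected graph, let $e=uv$ be a cut edge of $G$ with $\deg(u),\deg(v)\geq 2$, and let $G'=G\setminus\{e\}$. Then $$meg(G)\leq meg(G')\leq meg(G)+2.$$ Moreover, both the lower and the upper bounds are tight (i.e. each is attained with equality by some such $G$ and $e$).
   Context: Graphs are finite, undirected and simple. A cut edge is an edge whose removal increases the number of connected components. In a connected graph $H$, an edge $e$ is monitored by a pair of vertices $x,y$ if $e$ lies on all shortest paths between $x$ and $y$. A set $M\subseteq V(H)$ is a monitoring edge-geodetic set (MEG-set) of $H$ if every edge of $H$ is monitored by some pair of vertices of $M$; $meg(H)$ is the minimum size of a MEG-set of $H$. For a disconnected graph, a MEG-set is the union of MEG-sets of its connected components, where the MEG-set of an isolated vertex is taken to be empty; so $meg$ is the sum of the $meg$ of the components, an isolated vertex contributing $0$. *)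

(* Defs.v *)
From HB Require Import structures.
From mathcomp Require Import all_boot.
From mathcomp Require Import boolp.

Set Implicit Arguments.
Unset Strict Implicit.
Unset Printing Implicit Defensive.

Record sgraph := SGraph {
  vertex :> finType;
  adj : rel vertex;
  adj_sym : symmetric adj;
  adj_irrefl : irreflexive adj }.

Definition degree (G : sgraph) (x : G) : nat := #|[set y | adj x y]|.

Definition connected (G : sgraph) : bool :=
  (0 < #|G|) && [forall x : G, forall y : G, connect (@adj G) x y].

Definition components (G : sgraph) : {set {set G}} :=
  equivalence_partition (connect (@adj G)) [set: G].

Section Subgraphs.
Variable G : sgraph.

Definition induced_adj (A : {set G}) : rel {x : G | x \in A} :=
  relpre val (@adj G).

Lemma induced_adj_sym A : symmetric (@induced_adj A).
Proof. by move=> x y; apply: adj_sym. Qed.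

Lemma induced_adj_irrefl A : irreflexive (@induced_adj A).
Proof. by move=> x; apply: adj_irrefl. Qed.

Definition induced (A : {set G}) : sgraph :=
  SGraph (@induced_adj_sym A) (@induced_adj_irrefl A).

Definition del_adj (u v x y : G) : bool :=
  adj x y && ([set x; y] != [set u; v]).

Lemma del_adj_sym u v : symmetric (del_adj u v).
Proof. by move=> x y; rewrite /del_adj adj_sym setUC. Qed.

Lemma del_adj_irrefl u v : irreflexive (del_adj u v).
Proof. by move=> x; rewrite /del_adj adj_irrefl. Qed.

Definition del_edge (u v : G) : sgraph :=
  SGraph (@del_adj_sym u v) (@del_adj_irrefl u v).

Definition cut_edge (u v : G) : bool :=
  adj u v && (#|components G| < #|components (del_edge u v)|).

End Subgraphs.

Section Monitoring.
Variable G : sgraph.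

(* As in path.v, the path x = x_0, x_1, ..., x_k is given by its origin x and
   the sequence p = [:: x_1; ...; x_k]; its length is size p. *)
Definition is_path (x y : G) (p : seq G) : bool :=
  [&& path (@adj G) x p, uniq (x :: p) & last x p == y].

Definition shortest_path (x y : G) (p : seq G) : Prop :=
  is_path x y p /\ forall q : seq G, is_path x y q -> size p <= size q.

(* zip (x :: p) p lists the pairs of consecutive vertices of the path. *)
Definition edge_on_path (a b x : G) (p : seq G) : bool :=
  ((a, b) \in zip (x :: p) p) || ((b, a) \in zip (x :: p) p).

(* Only meaningful in a connected graph: the condition is vacuous when x and y
   lie in different components. *)
Definition monitored (a b x y : G) : Prop :=
  forall p : seq G, shortest_path x y p -> edge_on_path a b x p.

Definition conn_meg_set (M : {set G}) : Prop :=
  forall a b : G, adj a b ->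
  exists x y : G, [/\ x \in M, y \in M & monitored a b x y].

Lemma conn_meg_setT : conn_meg_set [set: G].
Proof.
move=> a b ab; exists a, b; split; rewrite ?inE // => p [pP pmin].
have abP : is_path a b [:: b].
  by rewrite /is_path /= ab inE eqxx !andbT; apply: contraTneq ab => ->;
     rewrite adj_irrefl.
have := pmin _ abP; case: p pP {pmin} => [|c [|//]] /and3P[/= _ _ /eqP].
  by move=> E; move: ab; rewrite E adj_irrefl.
by move=> -> _; rewrite /edge_on_path /= inE eqxx.
Qed.

End Monitoring.

(* The components of G partition its vertices, so a union of MEG-sets of the
   components is a set M whose trace on each component is a MEG-set of it. *)
Definition meg_set (G : sgraph) (M : {set G}) : Prop :=
  if connected G then conn_meg_set M
  else forall C : {set G}, C \in components G ->
    if #|C| == 1 then M :&: C = set0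
    else @conn_meg_set (induced C) [set x : induced C | val x \in M].

Lemma ex_meg_set (G : sgraph) :
  exists n, `[< exists2 M : {set G}, meg_set M & #|M| = n >].
Proof.
pose M := [set x : G | [forall C in components G, (x \in C) ==> (#|C| != 1)]].
case: (boolP (connected G)) => cG.
  exists #|[set: G]|; apply/asboolP; exists setT => //.
  by rewrite /meg_set cG; apply: conn_meg_setT.
exists #|M|; apply/asboolP; exists M => //.
rewrite /meg_set (negbTE cG) => C CG; case: ifP => [C1 | C1].
  apply/setP => x; rewrite !inE; apply: negbTE; apply/andP => -[/forall_inP xM].
  by move=> xC; have := xM C CG; rewrite xC C1.
suff -> : [set x : induced C | val x \in M] = setT by apply: conn_meg_setT.
apply/setP => -[x xC]; rewrite !inE /=.
apply/forall_inP => D DG; apply/implyP => xD.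
have eqR : {in [set: G] & &, equivalence_rel (connect (@adj G))}.
  move=> a b c _ _ _; split; first exact: connect0.
  by move=> ab; apply: (same_connect (sym_connect_sym (@adj_sym G))).
have /and3P[_ /trivIsetP tI _] := equivalence_partitionP eqR.
case: (eqVneq C D) => [<-|CD]; first by rewrite C1.
by have /pred0P/(_ x) := tI _ _ CG DG CD; rewrite /= xC xD.
Qed.

Definition meg (G : sgraph) : nat := ex_minn (ex_meg_set G).

(* Main.v *)
(** Removing the cut edge uv splits G into a side A containing u and its
    complement containing v.  A path with distinct vertices between two
    vertices of A stays in A, so distances and monitoring inside A are the same
    in G and in the component A.  Hence a MEG-set of the two components is a
    MEG-set of G, the edge uv being monitored by any two of its vertices on
    opposite sides.  Conversely, shortest paths across the cut are joined from
    shortest paths to u and from v, so replacing the far endpoint of a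
    monitoring pair by u or v keeps it monitoring the edges of the near side:
    adding u and v to a MEG-set of G suffices.  The lower bound is attained by
    two copies of K_{1,2} with adjacent centres, the upper bound by P_4. *)

Require Import Defs.
From mathcomp Require Import all_boot.
From mathcomp Require Import boolp.

Set Implicit Arguments.
Unset Strict Implicit.
Unset Printing Implicit Defensive.

(** * Consecutive pairs of a sequence and edges on a path *)

Lemma mem_zipr (S T : eqType) (s : seq S) (t : seq T) (a : S) (b : T) :
  (a, b) \in zip s t -> b \in t.
Proof.
elim: s t => [|c s IHs] [|d t] //=; rewrite !inE xpair_eqE.
by case/orP=> [/andP[_ ->] // | /IHs ->]; rewrite orbT.
Qed.

Lemma mem_zipl (S T : eqType) (s : seq S) (t : seq T) (a : S) (b : T) :
  (a, b) \in zip s t -> a \in s.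
Proof.
elim: s t => [|c s IHs] [|d t] //=; rewrite !inE xpair_eqE.
by case/orP=> [/andP[-> _] // | /IHs ->]; rewrite orbT.
Qed.

Lemma zip_path_cat (T : Type) (x v : T) (p1 p2 : seq T) :
  zip (x :: p1 ++ v :: p2) (p1 ++ v :: p2) =
  zip (x :: p1) p1 ++ (last x p1, v) :: zip (v :: p2) p2.
Proof. by elim: p1 x => [|z p1 IHp] x //=; rewrite -IHp. Qed.

Lemma zip_mapf (S T : Type) (f : S -> T) (s t : seq S) :
  zip (map f s) (map f t) = [seq (f xy.1, f xy.2) | xy <- zip s t].
Proof. by elim: s t => [|x s IHs] [|y t] //=; rewrite IHs. Qed.

Lemma eq_set2 (T : finType) (a b u v : T) :
  ([set a; b] == [set u; v]) = (a == u) && (b == v) || (a == v) && (b == u).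
Proof.
apply/eqP/idP => [E | /orP[] /andP[/eqP-> /eqP->] //]; last by rewrite setUC.
have := set21 u v; have := set22 u v; rewrite -E.
have := set21 a b; have := set22 a b; rewrite {1 2}E !inE.
rewrite ![u == _]eq_sym ![v == _]eq_sym.
by case: (a == u) (a == v) (b == u) (b == v) => [] [] [] [].
Qed.

Lemma edge_on_path_mem (G : sgraph) (a b x : G) (p : seq G) :
  edge_on_path a b x p -> (a \in p) || (b \in p).
Proof. by case/orP=> /mem_zipr ->; rewrite ?orbT. Qed.

Lemma edge_on_path_ends (G : sgraph) (a b x : G) (p : seq G) :
  edge_on_path a b x p -> (a \in x :: p) && (b \in x :: p).
Proof.
by case/orP=> ab; have := mem_zipl ab; have := mem_zipr ab;
  rewrite !inE => -> ->; rewrite ?orbT.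
Qed.

(** The joining edge is written as a one-edge path, so that facts such as [edge_on_path_mem] apply
    to it as to the two outer pieces. *)
Lemma edge_on_path_cat (G : sgraph) (a b x v : G) (p1 p2 : seq G) :
  edge_on_path a b x (p1 ++ v :: p2) =
  [|| edge_on_path a b x p1, edge_on_path a b (last x p1) [:: v]
    | edge_on_path a b v p2].
Proof.
rewrite /edge_on_path zip_path_cat !mem_cat /= !inE.
by do !case: (_ \in _); rewrite ?orbT //=; do !case: (_ == _).
Qed.

Lemma edge_on_pathC (G : sgraph) (a b x : G) (p : seq G) :
  edge_on_path a b x p = edge_on_path b a x p.
Proof. exact: orbC. Qed.

(** * Shortest paths and monitoring *)

Lemma monitoredC (G : sgraph) (a b x y : G) :
  monitored a b x y -> monitored b a x y.
Proof. by move=> mon p /mon; rewrite edge_on_pathC. Qed.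

Lemma connect_is_path (G : sgraph) (x y : G) :
  connect (@adj G) x y -> exists p, is_path x y p.
Proof.
case/connectP=> p /shortenP[q qP qU _] ->.
by exists q; rewrite /is_path qP qU eqxx.
Qed.

Lemma ex_shortest_path (G : sgraph) (x y : G) :
  connect (@adj G) x y -> exists p, shortest_path x y p.
Proof.
case/connect_is_path=> p0 p0P.
pose P n := `[< exists2 p, is_path x y p & size p = n >].
have exP : exists n, P n by exists (size p0); apply/asboolP; exists p0.
case: (ex_minnP exP) => n /asboolP[p pP <-] pmin.
by exists p; split=> // q qP; apply: pmin; apply/asboolP; exists q.
Qed.

(** From a vertex to itself the empty path is shortest, and it carries no edge. *)
Lemma monitored_neq (G : sgraph) (a b x y : G) : monitored a b x y -> x != y.
Proof.
move=> mon; apply/eqP => E; move: mon; rewrite -E => mon.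
suff : edge_on_path a b x [::] by [].
by apply: mon; split=> //; rewrite /is_path /= eqxx.
Qed.

(** The map [f] carries paths to paths of the same length, and the last hypothesis makes every path
    between [f x] and [f y] arise in this way; hence shortest paths and the edges on them
    correspond. It serves to compare a component with the whole graph. *)
Lemma monitored_embed (H G : sgraph) (f : H -> G) (a b x y : H) :
    injective f -> {mono f : c d / adj c d} ->
    (forall q, is_path (f x) (f y) q -> exists p, q = map f p) ->
  monitored (f a) (f b) (f x) (f y) <-> monitored a b x y.
Proof.
move=> f_inj f_adj f_conv.
have fpath p : is_path (f x) (f y) (map f p) = is_path x y p.
  rewrite /is_path path_map -map_cons map_inj_uniq // last_map inj_eq //.
  by rewrite (eq_path (e' := @adj H)) // => c d; apply: f_adj.
have fshort p : shortest_path (f x) (f y) (map f p) <-> shortest_path x y p.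
  rewrite /shortest_path fpath; split=> -[pP pmin]; split=> // q qP.
    by have := pmin (map f q); rewrite fpath !size_map; apply.
  have [r E] := f_conv q qP; move: qP; rewrite E fpath !size_map.
  exact: pmin.
have fedge p : edge_on_path (f a) (f b) (f x) (map f p) = edge_on_path a b x p.
  have f2_inj : injective (fun cd : H * H => (f cd.1, f cd.2)).
    by move=> [c d] [c' d'] /= [/f_inj-> /f_inj->].
  by rewrite /edge_on_path -map_cons zip_mapf (mem_map f2_inj _ (a, b))
    (mem_map f2_inj _ (b, a)).
split=> mon p pS; first by rewrite -fedge; apply: mon; apply/fshort.
have [r E] := f_conv p pS.1; move: pS; rewrite E fedge => /fshort; exact: mon.
Qed.

(** * Paths and monitoring relative to the two sides of a cut edge *)

(* A is the vertex set of the component of u after removal of the cut edge uv,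
   provided G is connected. *)
Definition cut_side (G : sgraph) (A : {set G}) (u v : G) : Prop :=
  [/\ adj u v, u \in A, v \notin A
    & forall a b, adj a b -> a \in A -> b \notin A -> a = u /\ b = v].

Lemma cut_sideC (G : sgraph) (A : {set G}) (u v : G) :
  cut_side A u v -> cut_side (~: A) v u.
Proof.
case=> uv uA vA cut; split; rewrite ?inE ?uA //; first by rewrite adj_sym.
move=> a b ab; rewrite !inE negbK => aA bA.
by have [] := cut b a; rewrite // adj_sym.
Qed.

(** The step at which the path first enters [A] can only be from [v] to [u]. *)
Lemma cut_side_through (G : sgraph) (A : {set G}) (u v x : G) (p : seq G) :
    cut_side A u v -> path (@adj G) x p -> x \notin A -> last x p \in A ->
  u \in p.
Proof.
case=> uv uA vA cut; elim: p x => [|z p IHp] x /=; first by move=> _ /negP.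
case/andP=> xz zp xA lA; rewrite inE; case zA: (z \in A).
  by have [|||<- //] := cut z x; rewrite ?eqxx // adj_sym.
by rewrite (IHp z) ?zA ?orbT.
Qed.

(* Leaving the side means using uv, and coming back would repeat u. *)
Lemma path_in_cut_side (G : sgraph) (A : {set G}) (u v x y : G) (p : seq G) :
    cut_side A u v -> is_path x y p -> x \in A -> y \in A ->
  all [in A] p.
Proof.
move=> cutA /and3P[pP pU /eqP E]; have [_ _ _ cut] := cutA; rewrite -E => {E y}.
elim: p x pP pU => [|z p IHp] x //= /andP[xz zp] /andP[xNp pU] xA lA.
case zA: (z \in A); first by rewrite (IHp z).
have [Ex _] := cut x z xz xA (negbT zA).
have up := cut_side_through cutA zp (negbT zA) lA.
by move: xNp; rewrite Ex inE up orbT.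
Qed.

(** The path is split at its first step out of [A], which must be from [u] to [v]. *)
Lemma path_across (G : sgraph) (A : {set G}) (u v x y : G) (p : seq G) :
    cut_side A u v -> is_path x y p -> x \in A -> y \notin A ->
  exists p1 p2, [/\ p = p1 ++ v :: p2, is_path x u p1 & is_path v y p2].
Proof.
move=> [_ _ _ cut] /and3P[pP pU /eqP E]; rewrite -E => {E y}.
elim: p x pP pU => [|z p IHp] x /=; first by move=> _ _ ->.
case/andP=> xz zp /andP[xNp pU] xA lA; case zA: (z \in A); last first.
  have [Ex Ez] := cut x z xz xA (negbT zA).
  exists [::], p; rewrite /is_path /= Ex Ez eqxx -Ez eqxx zp.
  by move: pU => /= ->.
have [p1 [p2 [Ep /and3P[p1P p1U p1l] p2P]]] := IHp z zp pU zA lA.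
exists (z :: p1), p2; split=> //; first by rewrite Ep.
rewrite /is_path /= xz p1P p1l.
move: p1U xNp; rewrite Ep /= => ->; rewrite !inE mem_cat !negb_or.
by case/and3P=> -> ->.
Qed.

(** Vertices stay distinct because the first piece remains in [A] and the second in its
    complement. *)
Lemma is_path_join (G : sgraph) (A : {set G}) (u v x y : G) (p1 p2 : seq G) :
    cut_side A u v -> x \in A -> y \notin A -> is_path x u p1 ->
    is_path v y p2 -> is_path x y (p1 ++ v :: p2).
Proof.
move=> cutA xA yA p1P p2P; have [uv uA vA _] := cutA.
have /allP p1A := path_in_cut_side cutA p1P xA uA.
have /allP p2A : all [in ~: A] p2.
  by apply: path_in_cut_side (cut_sideC cutA) p2P _ _; rewrite inE.
case/and3P: p1P p2P => p1P p1U /eqP p1l /and3P[p2P p2U p2l].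
have pU : uniq ((x :: p1) ++ v :: p2).
  rewrite cat_uniq p1U p2U andbT andTb; apply/hasPn => z zp2.
  have zA : z \notin A.
    by move: zp2; rewrite inE => /orP[/eqP-> // | /p2A]; rewrite inE.
  by apply: contra zA => /=; rewrite inE => /orP[/eqP-> // | /p1A].
by rewrite /is_path -cat_cons pU cat_path last_cat p1P /= p1l uv p2P.
Qed.

Lemma monitored_cut_side (G : sgraph) (A : {set G}) (u v x y : G) :
  cut_side A u v -> x \in A -> y \notin A -> monitored u v x y.
Proof.
move=> cutA xA yA p [pP _].
have [p1 [p2 [-> /and3P[_ _ /eqP p1l] _]]] := path_across cutA pP xA yA.
by rewrite edge_on_path_cat p1l /edge_on_path /= inE eqxx orbT.
Qed.

Lemma connectedW (G : sgraph) :
  connected G -> forall x y : G, connect (@adj G) x y.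
Proof. by case/andP=> _ /forallP h x y; apply/forallP. Qed.

(* Shortest x-y paths are the concatenations of a shortest x-u path, the edge
   uv and a shortest v-y path. *)
Lemma monitored_across (G : sgraph) (A : {set G}) (u v a b x y : G) :
    connected G -> cut_side A u v -> x \in A -> y \notin A ->
    monitored a b x y ->
  (a \in A -> b \in A -> monitored a b x u) /\
  (a \notin A -> b \notin A -> monitored a b v y).
Proof.
move=> /connectedW cG cutA xA yA mon; have [uv uA vA _] := cutA.
(* The concatenation is a shortest path: every competitor also splits at the edge [uv], and neither
   of its halves is shorter. *)
have join p1 p2 : shortest_path x u p1 -> shortest_path v y p2 ->
    [|| edge_on_path a b x p1, edge_on_path a b u [:: v]
      | edge_on_path a b v p2].
  move=> [p1P p1min] [p2P p2min].
  have /and3P[_ _ /eqP p1l] := p1P.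
  have := mon (p1 ++ v :: p2); rewrite edge_on_path_cat p1l; apply; split.
    exact: is_path_join cutA xA yA p1P p2P.
  move=> q /(path_across cutA)/(_ xA yA)[q1 [q2 [-> q1P q2P]]].
  by rewrite !size_cat leq_add ?p1min //= ltnS p2min.
have inA p : is_path x u p -> {subset p <= A}.
  by move=> pP; apply/allP; apply: path_in_cut_side cutA pP xA uA.
have outA p z : is_path v y p -> z \in p -> z \notin A.
  move=> pP zp; have : all [in ~: A] p.
    by apply: path_in_cut_side (cut_sideC cutA) pP _ _; rewrite inE.
  by move/allP/(_ z zp); rewrite inE.
split=> aA bA p pS.
  have [p2 p2S] := ex_shortest_path (cG v y).
  (* An edge inside [A] is neither [uv] nor on the half beyond [v], so it lies on [p]. *)
  case/or3P: (join _ _ pS p2S) => // /edge_on_path_mem.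
    by rewrite !inE => /orP[] /eqP E; move: vA; rewrite -E ?aA ?bA.
  by case/orP=> /(outA _ _ p2S.1); rewrite ?aA ?bA.
have [p1 p1S] := ex_shortest_path (cG x u).
case/or3P: (join _ _ p1S pS) => //.
  by case/edge_on_path_mem/orP=> /(inA _ p1S.1);
    rewrite ?(negbTE aA) ?(negbTE bA).
rewrite /edge_on_path /= !inE !xpair_eqE.
by case/orP=> /andP[/eqP E1 /eqP E2]; move: uA;
  rewrite -?E1 -?E2 ?(negbTE aA) ?(negbTE bA).
Qed.

(** Connectedness supplies a shortest path, so monitoring is not vacuous; that path stays in [A] and
    contains both ends of the edge. *)
Lemma monitored_same_side (G : sgraph) (A : {set G}) (u v a b x y : G) :
    connected G -> cut_side A u v -> x \in A -> y \in A -> monitored a b x y ->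
  (a \in A) && (b \in A).
Proof.
move=> /connectedW cG cutA xA yA mon.
have [p pS] := ex_shortest_path (cG x y).
have /allP pA : all [in A] (x :: p).
  by rewrite /= xA (path_in_cut_side cutA pS.1).
by have /andP[/pA-> /pA->] := edge_on_path_ends (mon p pS).
Qed.

(** * Components after deletion of a cut edge *)

Lemma del_adj_same_side (G : sgraph) (A : {set G}) (u v x y : G) :
  cut_side A u v -> (x \in A) = (y \in A) -> adj x y -> del_adj u v x y.
Proof.
case=> _ uA vA _ xyA xy; rewrite /del_adj xy eq_set2 /=.
apply/negP => /orP[] /andP[/eqP Ex /eqP Ey]; move: xyA vA.
  by rewrite Ex Ey uA => <-.
by rewrite Ex Ey uA => ->.
Qed.

Lemma del_adj_side (G : sgraph) (A : {set G}) (u v x y : G) :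
  cut_side A u v -> del_adj u v x y -> (x \in A) = (y \in A).
Proof.
case=> _ uA vA cut /andP[xy]; rewrite eq_set2.
case xA: (x \in A); case yA: (y \in A) => //.
  by have [||-> ->] := cut x y xy; rewrite ?xA ?yA ?eqxx.
by have [|||-> ->] := cut y x; rewrite ?xA ?yA ?eqxx ?orbT // adj_sym.
Qed.

(** Remaining edges never change side; conversely, a path of [G] between vertices of one side stays
    there and so avoids [uv]. *)
Lemma connect_del_edge (G : sgraph) (A : {set G}) (u v x y : G) :
    connected G -> cut_side A u v ->
  connect (del_adj u v) x y = ((x \in A) == (y \in A)).
Proof.
move=> /connectedW cG cutA; apply/idP/eqP => [/connectP[p] | xyA].
  elim: p x => [|z p IHp] x /=; first by move=> _ ->.
  by case/andP=> /(del_adj_side cutA) -> zp /(IHp _ zp) ->.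
(* Exchanging the two sides swaps [u] and [v] but deletes the same unordered edge. *)
wlog xA : A u v cutA xyA / x \in A => [wl|].
  case xA: (x \in A); first exact: (wl A u v).
  rewrite (eq_connect (e' := del_adj v u)).
    by apply: (wl (~: A) v u (cut_sideC cutA)); rewrite !inE -?xyA ?xA.
  by move=> a b; rewrite /= /del_adj [[set u; v]]setUC.
have [p pP] := connect_is_path (cG x y).
have pA : all [in A] (x :: p).
  by rewrite /= xA (path_in_cut_side cutA pP) // -xyA.
case/and3P: pP => pP _ /eqP <-; apply/connectP; exists p => //.
apply: sub_in_path pA pP => a b aA bA; apply: (del_adj_same_side cutA).
by move: aA bA => /= -> ->.
Qed.

Lemma in_components (G : sgraph) (C : {set G}) :
  reflect (exists x, C = [set y | connect (@adj G) x y]) (C \in components G).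
Proof.
apply: (iffP imsetP) => [[x _ ->] | [x ->]]; exists x => //;
by apply/setP => y; rewrite !inE.
Qed.

Lemma components_del_edge (G : sgraph) (A C : {set G}) (u v : G) :
    connected G -> cut_side A u v ->
  (C \in components (del_edge u v)) = (C == A) || (C == ~: A).
Proof.
move=> cG cutA; have [_ uA vA _] := cutA.
have comp x : [set y | connect (del_adj u v) x y] = if x \in A then A else ~: A.
  apply/setP => y; rewrite inE (connect_del_edge _ _ cG cutA).
  by case: (x \in A); rewrite ?inE; case: (y \in A).
apply/in_components/idP => [[x ->] | /orP[]/eqP->]; rewrite ?comp.
- by case: ifP; rewrite eqxx ?orbT.
- by exists u; rewrite comp uA.
- by exists v; rewrite comp (negbTE vA).
Qed.

Lemma card_components_connected (G : sgraph) :
  connected G -> #|components G| <= 1.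
Proof.
move=> /connectedW cG; apply/card_le1_eqP => C D.
by move=> /in_components[x ->] /in_components[y ->];
  apply/setP => z; rewrite !inE !cG.
Qed.

(** The side is what [u] reaches without the edge. If [v] were in it, deletion would not change
    reachability, so the number of components would not grow. *)
Lemma cut_edgeP (G : sgraph) (u v : G) :
  connected G -> reflect (exists A, cut_side A u v) (cut_edge u v).
Proof.
move=> cG; apply: (iffP andP) => [[uv ltc] | [A cutA]]; last first.
  have [uv uA vA _] := cutA; split=> //.
  (* There is at most one component before deletion, and [A] and its complement are two
     afterwards. *)
  apply: leq_ltn_trans (card_components_connected cG) _; apply/card_gt1P.
  exists A, (~: A); rewrite !(components_del_edge _ cG cutA) !eqxx orbT.
  by split=> //; apply/eqP => /setP/(_ u); rewrite inE uA.
have symD := sym_connect_sym (@del_adj_sym G u v).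
pose A : {set G} := [set x | connect (del_adj u v) u x].
have uA : u \in A by rewrite inE connect0.
exists A; split=> //.
  apply: contraL ltc; rewrite inE => Duv; rewrite -leqNgt.
  suff E : connect (del_adj u v) =2 connect (@adj G).
    rewrite [_ <= _]eq_leq //; congr #|pred_of_set _|; apply: eq_imset => x.
    by apply/setP => y; rewrite !inE E.
  move=> x y; apply/idP/idP => [|xy]; last first.
    move: xy; apply: connect_sub => a b ab.
    case abD: (del_adj u v a b); first exact: connect1.
    move: abD; rewrite /del_adj ab eq_set2 /= => /negbFE.
    by case/orP=> /andP[/eqP-> /eqP->] //; rewrite symD.
  by apply: connect_sub => a b /andP[ab _]; apply: connect1.
move=> a b ab; rewrite !inE => aA bA.
have : ~~ del_adj u v a b.
  by apply: contra bA => /connect1; apply: connect_trans.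
rewrite /del_adj ab eq_set2 negbK => /orP[]/andP[/eqP Ea /eqP Eb] //.
by move: bA; rewrite Eb connect0.
Qed.

(** * MEG-sets of the two sides and the bounds *)

(** Monitoring is taken in [G] rather than in the induced subgraph, which keeps both sides on the
    vertex type of [G]. *)
Definition side_meg_set (G : sgraph) (A M : {set G}) : Prop :=
  forall a b : G, adj a b -> a \in A -> b \in A ->
  exists x y : G, [/\ x \in M :&: A, y \in M :&: A & monitored a b x y].

(** This is [monitored_embed] for the inclusion of a component: the deleted edge does not join two
    of its vertices, and paths of [G] between its vertices do not leave it. *)
Lemma induced_del_edge_meg (G : sgraph) (A C M : {set G}) (u v : G) :
    connected G -> cut_side A u v -> C \in components (del_edge u v) ->
    @conn_meg_set (@induced (del_edge u v) C) [set x | val x \in M] <->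
  side_meg_set C M.
Proof.
move=> cG cutA; rewrite (components_del_edge _ cG cutA) => CA.
pose H := @induced (del_edge u v) C; pose f : H -> G := val.
have fC (x : H) : f x \in C by apply: (valP x).
have f_adj : {mono f : c d / adj c d}.
  move=> c d; apply/idP/idP => [|/andP[] //].
  apply: (del_adj_same_side cutA); have := fC c; have := fC d.
  case/orP: CA => /eqP->; first by move=> -> ->.
  by rewrite !inE => /negbTE-> /negbTE->.
have tr a b x y : monitored (f a) (f b) (f x) (f y) <-> @monitored H a b x y.
  apply: monitored_embed => //; first exact: val_inj.
  move=> q qP; have : all [in C] q.
    move: (fC x) (fC y); case/orP: CA => /eqP->.
      exact: path_in_cut_side cutA qP.
    exact: path_in_cut_side (cut_sideC cutA) qP.
  (* A sequence of vertices of [C] is lifted to the subtype, one entry at a time. *)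
  elim: q {qP} => [|c q IHq] /=; first by exists [::].
  by case/andP=> cC /IHq[p ->]; exists (Sub c cC :: p).
split=> meg a b => [ab aC bC | ab].
  have [|x [y [xM yM]]] := meg (Sub a aC : H) (Sub b bC : H).
    by rewrite -f_adj.
  move/tr => mon; exists (f x), (f y); move: xM yM; rewrite !inE !fC.
  by move=> -> ->.
have [|x [y [/setIP[xM xC] /setIP[yM yC] mon]]] := meg _ _ _ (fC a) (fC b).
  by rewrite f_adj.
exists (Sub x xC : H), (Sub y yC : H); rewrite !inE; split=> //; exact/tr.
Qed.

(** Of two distinct neighbours of [u] one differs from [v], and the edge to it does not cross. *)
Lemma cut_side_neighbor (G : sgraph) (A : {set G}) (u v : G) :
  cut_side A u v -> 2 <= degree u -> exists2 w, adj u w & w \in A.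
Proof.
case=> uv uA vA cut /card_gt1P[c [d]]; rewrite !inE => -[uc ud cd].
have [w uw wv] : exists2 w, adj u w & w != v.
  case: (eqVneq c v) cd => [->|cv _]; last by exists c.
  by exists d => //; rewrite eq_sym.
by exists w => //; apply: contraNT wv => /(cut _ _ uw uA)[_ ->].
Qed.

(** The degree conditions give each side at least two vertices, which excludes the isolated-vertex
    clause of [meg_set]. *)
Lemma meg_set_del_edge (G : sgraph) (A M : {set G}) (u v : G) :
    connected G -> cut_side A u v -> 2 <= degree u -> 2 <= degree v ->
  @meg_set (del_edge u v) M <-> side_meg_set A M /\ side_meg_set (~: A) M.
Proof.
move=> cG cutA du dv; have [uv uA vA _] := cutA.
have big (B : {set G}) x y :
    cut_side B x y -> 2 <= degree x -> #|B| == 1 = false.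
  move=> cutB dx; have [z xz zB] := cut_side_neighbor cutB dx.
  have [_ xB _ _] := cutB; apply/negbTE; rewrite neq_ltn orbC.
  apply/orP; left; apply/card_gt1P; exists x, z; split=> //.
  by apply: contraTneq xz => ->; rewrite adj_irrefl.
have cutC := cut_sideC cutA.
rewrite /meg_set ifN; last first.
  apply/negP => /connectedW/(_ u v).
  by rewrite (connect_del_edge _ _ cG cutA) uA (negbTE vA).
have AD : A \in components (del_edge u v).
  by rewrite (components_del_edge _ cG cutA) eqxx.
have CD : ~: A \in components (del_edge u v).
  by rewrite (components_del_edge _ cG cutA) eqxx orbT.
have indA := induced_del_edge_meg M cG cutA AD.
have indC := induced_del_edge_meg M cG cutA CD.
split=> [meg | [megA megC] C].
  have := meg A AD; have := meg (~: A) CD.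
  by rewrite (big _ _ _ cutA) // (big _ _ _ cutC) // => /indC ? /indA.
rewrite (components_del_edge _ cG cutA) => /orP[]/eqP->.
  by rewrite (big _ _ _ cutA) //; apply/indA.
by rewrite (big _ _ _ cutC) //; apply/indC.
Qed.

Lemma meg_le (G : sgraph) (M : {set G}) : meg_set M -> meg G <= #|M|.
Proof.
move=> megM; rewrite /meg; case: ex_minnP => n _; apply.
by apply/asboolP; exists M.
Qed.

Lemma meg_attained (G : sgraph) : exists2 M : {set G}, meg_set M & #|M| = meg G.
Proof. by rewrite /meg; case: ex_minnP => n /asboolP. Qed.

Lemma meg_set_connected (G : sgraph) (M : {set G}) :
  connected G -> meg_set M <-> conn_meg_set M.
Proof. by rewrite /meg_set => ->. Qed.

Lemma side_meg_set_neq0 (G : sgraph) (A M : {set G}) (u v : G) :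
    cut_side A u v -> 2 <= degree u -> side_meg_set A M ->
  exists2 x, x \in M & x \in A.
Proof.
move=> cutA du meg; have [_ uA _ _] := cutA.
have [w uw wA] := cut_side_neighbor cutA du.
by have [x [_ [/setIP[xM xA] _ _]]] := meg u w uw uA wA; exists x.
Qed.

(** An edge within a side is monitored from that side; the only other edge is [uv], for which one
    vertex of [M] on each side is enough. *)
Lemma side_meg_sets_conn (G : sgraph) (A M : {set G}) (u v : G) :
    cut_side A u v -> 2 <= degree u -> 2 <= degree v ->
    side_meg_set A M -> side_meg_set (~: A) M -> conn_meg_set M.
Proof.
move=> cutA du dv megA megC; have [_ _ _ cut] := cutA.
have [x xM xA] := side_meg_set_neq0 cutA du megA.
have [y yM] := side_meg_set_neq0 (cut_sideC cutA) dv megC.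
rewrite inE => yA; have mon := monitored_cut_side cutA xA yA.
move=> a b ab; case aA: (a \in A); case bA: (b \in A).
- have [c [d [/setIP[cM _] /setIP[dM _] cd]]] := megA a b ab aA bA.
  by exists c, d.
- by have [-> ->] := cut a b ab aA (negbT bA); exists x, y.
- have [|-> ->] := cut b a _ bA (negbT aA); first by rewrite adj_sym.
  by exists x, y; split=> //; apply: monitoredC.
- have [||c [d [/setIP[cM _] /setIP[dM _] cd]]] := megC a b ab.
  + by rewrite inE aA.
  + by rewrite inE bA.
  by exists c, d.
Qed.

(** The cases are the positions of the monitoring pair: inside [A] it is kept, across the cut its
    far vertex becomes [u], and outside [A] it cannot monitor an edge of [A]. *)
Lemma conn_meg_set_side (G : sgraph) (A M : {set G}) (u v : G) :
    connected G -> cut_side A u v -> conn_meg_set M ->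
  side_meg_set A (u |: M).
Proof.
move=> cG cutA meg a b ab aA bA; have [_ uA _ _] := cutA.
have cutC := cut_sideC cutA.
have [x [y [xM yM mon]]] := meg a b ab.
case xA: (x \in A); case yA: (y \in A).
- by exists x, y; rewrite !inE xM yM xA yA !orbT.
- have [/(_ aA bA) monu _] := monitored_across cG cutA xA (negbT yA) mon.
  by exists x, u; rewrite !inE xM xA uA eqxx orbT.
- have [||_ monu] := monitored_across cG cutC _ _ mon; rewrite ?inE ?xA ?yA //.
  exists u, y; rewrite !inE yM yA uA eqxx orbT; split=> //.
  by apply: monu; rewrite inE negbK.
- have := monitored_same_side cG cutC _ _ mon.
  by rewrite !inE xA yA aA bA => /(_ isT isT)/andP[].
Qed.

Lemma side_meg_setS (G : sgraph) (A M N : {set G}) :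
  M \subset N -> side_meg_set A M -> side_meg_set A N.
Proof.
move=> MN meg a b ab aA bA; have [x [y [xM yM mon]]] := meg a b ab aA bA.
by exists x, y; split=> //; apply: (subsetP (setSI A MN)).
Qed.

Lemma meg_del_edge_bounds (G : sgraph) (u v : G) :
    connected G -> cut_edge u v -> 2 <= degree u -> 2 <= degree v ->
  meg G <= meg (del_edge u v) /\ meg (del_edge u v) <= meg G + 2.
Proof.
move=> cG /(cut_edgeP _ _ cG)[A cutA] du dv; split.
  have [M megM <-] := meg_attained (del_edge u v).
  have /(meg_set_del_edge _ cG cutA du dv)[megA megC] := megM.
  apply: meg_le; apply/(meg_set_connected _ cG).
  exact: side_meg_sets_conn cutA du dv megA megC.
have [M /(meg_set_connected _ cG) megM <-] := meg_attained G.
(* One enlarged set serves both sides: [u] is added for [A], [v] for its complement. *)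
apply: (@leq_trans #|[set u; v] :|: M|); last first.
  rewrite addnC (leq_trans (leq_card_setU _ _)) // leq_add2r cards2.
  by case: (_ != _).
apply: (@meg_le (del_edge u v)).
apply/(meg_set_del_edge _ cG cutA du dv); split.
  apply: side_meg_setS (conn_meg_set_side cG cutA megM).
  by rewrite setSU ?sub1set ?set21.
apply: side_meg_setS (conn_meg_set_side cG (cut_sideC cutA) megM).
by rewrite setSU ?sub1set ?set22.
Qed.

(** * Double stars and their MEG-sets *)

(* Two stars with leaves indexed by T and adjacent centres (_, None): for
   T = unit this is the path P4. *)
Definition double_star_adj (T : finType) (x y : bool * option T) : bool :=
  if x.1 == y.1 then isSome x.2 (+) isSome y.2
  else ~~ isSome x.2 && ~~ isSome y.2.

Lemma double_star_adj_sym (T : finType) : symmetric (@double_star_adj T).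
Proof.
by move=> x y; rewrite /double_star_adj eq_sym addbC [~~ _ && _]andbC.
Qed.

Lemma double_star_adj_irrefl (T : finType) : irreflexive (@double_star_adj T).
Proof. by move=> x; rewrite /double_star_adj eqxx addbb. Qed.

Definition double_star (T : finType) : sgraph :=
  SGraph (@double_star_adj_sym T) (@double_star_adj_irrefl T).

Definition double_star_side (T : finType) (s : bool) : {set double_star T} :=
  [set x | x.1 == s].

Definition double_star_leaves (T : finType) : {set double_star T} :=
  [set (x.1, Some x.2) | x : bool * T].

Definition double_star_centre (T : finType) (s : bool) : double_star T :=
  (s, None).

Definition double_star_leaf (T : finType) (s : bool) (t : T) : double_star T :=
  (s, Some t).

Lemma double_star_leafP (T : finType) (s : bool) (t : T) :
  double_star_leaf s t \in double_star_leaves T.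
Proof. by apply/imsetP; exists (s, t). Qed.

Lemma card_double_star_leaves (T : finType) :
  #|double_star_leaves T| = 2 * #|T|.
Proof.
by rewrite card_imset ?card_prod ?card_bool // => -[s t] [s' t'] [-> ->].
Qed.

Lemma double_star_adj_centre_leaf (T : finType) (s : bool) (t : T) :
  adj (double_star_centre T s) (double_star_leaf s t).
Proof. by rewrite /= /double_star_adj eqxx. Qed.

Lemma double_star_adj_centres (T : finType) (s : bool) :
  adj (double_star_centre T s) (double_star_centre T (~~ s)).
Proof. by case: s. Qed.

(** Up to orientation every edge is pendant or the central one. *)
Lemma double_star_edge_ind (T : finType)
    (P : double_star T -> double_star T -> Prop) :
    (forall a b, P a b -> P b a) ->
    (forall s t, P (double_star_centre T s) (double_star_leaf s t)) ->
    (forall s, P (double_star_centre T s) (double_star_centre T (~~ s))) ->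
  forall a b, adj a b -> P a b.
Proof.
move=> PC Pl Pc [s o] [s' o'] /=; rewrite /double_star_adj /=.
case: eqVneq => [<- | ss']; case: o o' => [t|] [t'|] // _.
- exact/PC/Pl.
- exact: Pl.
- by have -> : s' = ~~ s; [case: s s' ss' => [] [] | apply: Pc].
Qed.

Lemma double_star_connected (T : finType) : connected (double_star T).
Proof.
apply/andP; split; first by apply/card_gt0P; exists (double_star_centre T true).
have cc x : connect (@adj (double_star T)) (double_star_centre T true) x.
  case: x => s o; apply: (@connect_trans _ _ (double_star_centre T s)).
    by case: s; [exact: connect0 | exact/connect1/double_star_adj_centres].
  case: o => [t|]; last exact: connect0.
  exact/connect1/double_star_adj_centre_leaf.
apply/forallP => x; apply/forallP => y; apply: connect_trans (cc y).
by rewrite (sym_connect_sym (@adj_sym (double_star T))).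
Qed.

Lemma double_star_cut_centre (T : finType) (s : bool) :
  cut_side (double_star_side T s) (double_star_centre T s)
    (double_star_centre T (~~ s)).
Proof.
split; rewrite ?inE //; first exact: double_star_adj_centres.
  by case: s.
case=> [s1 [t1|]] [s2 [t2|]]; rewrite /= /double_star_adj !inE /=;
by case: s s1 s2 => [] [] [].
Qed.

(** A single leaf is a side of its pendant edge, so the results on sides apply to pendant edges
    too. *)
Lemma double_star_cut_leaf (T : finType) (s : bool) (t : T) :
  cut_side [set double_star_leaf s t] (double_star_leaf s t)
    (double_star_centre T s).
Proof.
split; rewrite ?inE //; first by rewrite adj_sym double_star_adj_centre_leaf.
  by rewrite xpair_eqE andbF.
move=> a [s' o] ab; rewrite !inE => /eqP Ea _; move: ab.
by rewrite Ea /= /double_star_adj /=; case: eqVneq => // <-; case: o.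
Qed.

Lemma double_star_degree (T : finType) (s : bool) :
  0 < #|T| -> 2 <= degree (double_star_centre T s).
Proof.
case/card_gt0P=> t _; apply/card_gt1P.
exists (double_star_leaf s t), (double_star_centre T (~~ s)).
split; last by rewrite xpair_eqE andbF.
  by rewrite in_set double_star_adj_centre_leaf.
by rewrite in_set double_star_adj_centres.
Qed.

Lemma double_star_leaf_monitored (T : finType) (s : bool) (t : T) y :
    y != double_star_leaf s t ->
  monitored (double_star_centre T s) (double_star_leaf s t)
    (double_star_leaf s t) y.
Proof.
move=> yt; apply/monitoredC/(monitored_cut_side (double_star_cut_leaf s t)).
  exact: set11.
by rewrite inE.
Qed.

Lemma double_star_leaves_meg (T : finType) :
  0 < #|T| -> conn_meg_set (double_star_leaves T).
Proof.
case/card_gt0P=> t0 _; apply: double_star_edge_ind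
    => [a b [x [y [xM yM mon]]]|s t|s].
- by exists x, y; split=> //; apply: monitoredC.
- exists (double_star_leaf s t), (double_star_leaf (~~ s) t).
  rewrite !double_star_leafP; split=> //; apply: double_star_leaf_monitored.
  by case: s.
exists (double_star_leaf s t0), (double_star_leaf (~~ s) t0).
rewrite !double_star_leafP; split=> //.
by apply: monitored_cut_side (double_star_cut_centre T s) _ _; rewrite inE //;
  case: s.
Qed.

(** A pair avoiding a leaf lies in the complement of that leaf, hence cannot monitor its pendant
    edge. *)
Lemma double_star_leaves_min (T : finType) (M : {set double_star T}) :
  conn_meg_set M -> double_star_leaves T \subset M.
Proof.
move=> meg; apply/subsetP => _ /imsetP[[s t] _ ->] /=.
rewrite -/(double_star_leaf s t).
have cG := double_star_connected T; have cut := double_star_cut_leaf s t.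
have [x [y [xM yM mon]]] := meg _ _ (double_star_adj_centre_leaf s t).
case xl: (x \in [set double_star_leaf s t]); first by move/set1P: xl => <-.
case yl: (y \in [set double_star_leaf s t]); first by move/set1P: yl => <-.
have := monitored_same_side cG (cut_sideC cut) _ _ mon.
rewrite [x \in _]in_setC xl [y \in _]in_setC yl => /(_ isT isT)/andP[_].
by rewrite in_setC set11.
Qed.

Lemma meg_double_star (T : finType) :
  0 < #|T| -> meg (double_star T) = 2 * #|T|.
Proof.
move=> T0; have cG := double_star_connected T; rewrite -card_double_star_leaves.
apply/eqP; rewrite eqn_leq; apply/andP; split.
  by apply: meg_le; apply/(meg_set_connected _ cG)/double_star_leaves_meg.
have [M /(meg_set_connected _ cG) megM <-] := meg_attained (double_star T).
exact/subset_leq_card/double_star_leaves_min.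
Qed.

(** * Double stars without their central edge *)

Lemma double_star_sideC (T : finType) (s : bool) :
  ~: double_star_side T s = double_star_side T (~~ s).
Proof. by apply/setP => -[[] o]; rewrite !inE; case: s. Qed.

Definition double_star_del (T : finType) : sgraph :=
  del_edge (double_star_centre T true) (double_star_centre T false).

Lemma meg_set_double_star_del (T : finType) (M : {set double_star T}) :
    0 < #|T| ->
    @meg_set (double_star_del T) M <->
  forall s, side_meg_set (double_star_side T s) M.
Proof.
move=> T0; have cG := double_star_connected T.
have megE := meg_set_del_edge M cG (double_star_cut_centre T true)
  (double_star_degree true T0) (double_star_degree false T0).
split=> [/megE[] | meg]; last by apply/megE; rewrite double_star_sideC.
by rewrite double_star_sideC => megt megf [].
Qed.

(** With at least two leaves per star, each leaf is paired with another leaf of its own star, so the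
    leaves still suffice after deletion. *)
Lemma meg_double_star_del_le (T : finType) :
    2 <= #|T| ->
  meg (double_star_del T) <= 2 * #|T|.
Proof.
case/card_gt1P=> t1 [t2 [_ _ t12]]; rewrite -card_double_star_leaves.
have T0 : 0 < #|T| by apply/card_gt0P; exists t1.
apply: (@meg_le (double_star_del T)).
apply/(meg_set_double_star_del _ T0) => s0.
apply: double_star_edge_ind => [a b meg bA aA|s t|s].
- have [x [y [xM yM mon]]] := meg aA bA.
  by exists x, y; split=> //; apply: monitoredC.
- rewrite inE => /eqP /= <- _.
  have [t' tt'] : exists t', t' != t.
    by case: (eqVneq t1 t) => [<-|]; [exists t2; rewrite eq_sym | exists t1].
  exists (double_star_leaf s t), (double_star_leaf s t').
  rewrite !in_setI !double_star_leafP !inE eqxx; split=> //.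
  apply: double_star_leaf_monitored; apply: contra tt'.
  by rewrite xpair_eqE => /andP[_ /eqP[->]].
(* The centres lie on opposite sides, so the central edge belongs to neither. *)
- by rewrite !inE /=; case: s s0 => [] [].
Qed.

(** Deletion leaves two copies of K_2. A monitoring pair has distinct vertices, so it takes up both
    vertices of its copy, and all four are needed. *)
Lemma meg_path4_del_ge :
  4 <= meg (double_star_del unit).
Proof.
have T0 : 0 < #|{: unit}| by rewrite card_unit.
have [M /(meg_set_double_star_del _ T0) meg <-] :=
  meg_attained (double_star_del unit).
suff -> : M = [set: double_star unit].
  by rewrite cardsT card_prod card_option card_bool card_unit.
apply/setP => -[s o]; rewrite in_setT.
have [||x [y [xM yM /monitored_neq]]] :=
  meg s _ _ (double_star_adj_centre_leaf s tt); rewrite ?inE //.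
move: xM yM; rewrite !inE => /andP[xM /eqP xs] /andP[yM /eqP ys].
case: x y xs ys xM yM => _ [[]|] [_ [[]|]] /= -> ->; case: o => [[]|] // ->;
by rewrite ?eqxx.
Qed.

Theorem theorem4p7 :
  (forall (G : sgraph) (u v : G),
     connected G -> cut_edge u v -> 2 <= degree u -> 2 <= degree v ->
     meg G <= meg (del_edge u v) /\ meg (del_edge u v) <= meg G + 2)
  /\ (exists (G : sgraph) (u v : G),
        [/\ connected G, cut_edge u v, 2 <= degree u, 2 <= degree v
          & meg (del_edge u v) = meg G])
  /\ (exists (G : sgraph) (u v : G),
        [/\ connected G, cut_edge u v, 2 <= degree u, 2 <= degree v
          & meg (del_edge u v) = meg G + 2]).
Proof.
have cut T : cut_edge (double_star_centre T true) (double_star_centre T false).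
  apply/(cut_edgeP _ _ (double_star_connected T)).
  by exists (double_star_side T true); apply: double_star_cut_centre.
have bounds (T : finType) (T0 : 0 < #|T|) := meg_del_edge_bounds
  (double_star_connected T) (cut T)
  (double_star_degree true T0) (double_star_degree false T0).
split; first exact: meg_del_edge_bounds.
(* For [bool] the value is 4 before and after deletion; for [unit] it rises from 2 to 4. In each
   case one inequality is the general bound. *)
split; [pose T : finType := bool | pose T : finType := unit].
  have T0 : 0 < #|T| by rewrite card_bool.
  exists (double_star T), (double_star_centre T true).
  exists (double_star_centre T false).
  split; rewrite ?double_star_degree ?double_star_connected ?cut //.
  have [lb _] := bounds T T0; apply/eqP; rewrite eqn_leq lb andbT.
  by rewrite meg_double_star // meg_double_star_del_le // card_bool.
have T0 : 0 < #|T| by rewrite card_unit.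
exists (double_star T), (double_star_centre T true).
exists (double_star_centre T false).
split; rewrite ?double_star_degree ?double_star_connected ?cut //.
have [_ ub] := bounds T T0; apply/eqP; rewrite eqn_leq ub.
by rewrite meg_double_star // card_unit meg_path4_del_ge.
Qed.
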